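(* Let $G$ be a finite group. Then $G$ is cyclic if and only if its subgroup lattice does not contain a diamond with top a subgroup $H\leq G$, middle elements $\langle x\rangle, \langle y\rangle, \langle z\rangle$ and bottom $\langle a\rangle$, for elements $x,y,z,a\in G$, where $\langle a\rangle$ is a maximal subgroup of both $\langle x\rangle$ and $\langle y\rangle$.
   Context: $\langle x_1,\ldots,x_n\rangle$ denotes the subgroup generated by $x_1,\ldots,x_n$. In the lattice of subgroups of a group, the meet $A\wedge B$ is $A\cap B$ and the join $A\vee B$ is the subgroup generated by $A\cup B$. A diamond (a sublattice isomorphic to $M_3$) with top $T$, middle elements $A,B,C$ and bottom $D$ consists of five pairwise distinct subgroups such that $A\vee B=A\vee C=B\vee C=T$ and $A\wedge B=A\wedge C=B\wedge C=D$. The top $H$ is not required to be cyclic. *)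

(* Defs.v *)
From mathcomp Require Import all_boot all_fingroup all_solvable.

Set Implicit Arguments.
Unset Strict Implicit.
Unset Printing Implicit Defensive.

Local Open Scope group_scope.

(* [uniq] is taken at type {group gT}, where equality is equality of the
   underlying sets. *)
Definition diamond (gT : finGroupType) (T A B C D : {group gT}) : Prop :=
  [/\ uniq [:: T; A; B; C; D],
      [/\ A <*> B = T, A <*> C = T & B <*> C = T] &
      [/\ A :&: B = D, A :&: C = D & B :&: C = D]].

(* Main.v *)
Require Import Defs.
From mathcomp Require Import all_boot all_fingroup all_solvable.

(** Two ideas carry the proof.

    In a cyclic group a subgroup is determined by its order, and the product
    formula recovers the order of [B] from those of [A], [A <*> B] and
    [A :&: B]; so two complements [B] and [C] of [A] in the same interval
    coincide, which rules out every diamond.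

    Conversely, a noncyclic group contains a minimal noncyclic subgroup [M],
    all of whose proper subgroups are cyclic. The key fact
    ([minimal_noncyclic_cap]) is that the maximal subgroups of such an [M] meet
    pairwise in one and the same subgroup [D]: the centre if [M] is not
    abelian, and the trivial subgroup otherwise. Away from [D] the maximal
    subgroups thus partition [M]; hence subgroups lying strictly above [D] in
    two different maximal subgroups not only meet in [D] but also generate [M],
    since a maximal subgroup containing both would have to be equal to each of
    the two maximal subgroups one started with. As [M] is not the union of two
    proper subgroups, it has three maximal subgroups [A], [B] and [C]
    ([three_maximal]). Shrinking [A] and [B] to subgroups in which [D] is
    maximal, and keeping [C], produces the diamond; its middle and bottom are
    proper in [M], hence cyclic. This route avoids the classification of the
    minimal noncyclic groups. *)

Local Open Scope group_scope.

Section CyclicDiamond.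

Set Implicit Arguments.
Unset Strict Implicit.

Variable gT : finGroupType.
Implicit Types A B C D G K L M T X Y Z : {group gT}.

Lemma cyclic_genP A : cyclic A -> exists x, A = <[x]>%G.
Proof. by case/cyclicP=> x Ax; exists x; apply: val_inj. Qed.

(** The abelian hypothesis makes [A <*> B] the set product, so that its order
    is given by the product formula. *)
Lemma abelian_eq_card_complements T A B C :
    abelian T -> A <*> B = T -> A <*> C = T -> A :&: B = A :&: C ->
  #|B| = #|C|.
Proof.
move=> abT joinB joinC eqI.
have sub_AT: A \subset T by rewrite -joinB joing_subl.
have prod (K : {group gT}) : A <*> K = T -> (#|A| * #|K| = #|T| * #|A :&: K|)%N.
  move=> joinK; rewrite -joinK norm_joinEr ?mul_cardG //.
  by apply/cents_norm/(centSS _ sub_AT abT); rewrite -joinK joing_subr.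
apply/eqP; rewrite -(eqn_pmul2l (cardG_gt0 A)).
by rewrite (prod B joinB) (prod C joinC) eqI.
Qed.

Lemma cyclic_no_diamond T A B C D : cyclic T -> ~ diamond T A B C D.
Proof.
move=> cycT [uniqT [joinAB joinAC _] [meetAB meetAC _]].
have eqBC: B = C.
  apply: val_inj; apply/eqP; rewrite /= (eq_subG_cyclic cycT).
  - apply/eqP; apply: (@abelian_eq_card_complements T A) => //.
      exact: cyclic_abelian.
    by rewrite meetAB.
  - by rewrite -joinAB joing_subr.
  - by rewrite -joinAC joing_subr.
by move: uniqT; rewrite eqBC /= !inE eqxx /= !andbF.
Qed.

Lemma maximal_proper A M : maximal A M -> A \proper M.
Proof. exact: maxgroupp. Qed.

Lemma maximal_not_sub A B M :
  maximal A M -> maximal B M -> A != B -> ~~ (A \subset B).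
Proof.
move=> /maxgroupP[_ maxA] /maxgroupP[prB _]; apply: contraNN => sAB.
by apply/eqP/val_inj; rewrite /= (maxA B).
Qed.

(** Every element of a noncyclic group generates a proper subgroup, so it lies
    in a maximal one. A product of an element of [B] outside [A] with an
    element of [A] outside [B] avoids both, which yields the third maximal
    subgroup. *)
Lemma three_maximal M :
    ~~ cyclic M ->
  exists A B C : {group gT}, [/\ maximal A M, maximal B M & maximal C M]
             /\ [/\ A != B, A != C & B != C].
Proof.
move=> ncM.
have cover x : x \in M -> exists2 K : {group gT}, maximal K M & x \in K.
  move=> Mx; have sxM: <[x]> \subset M by rewrite cycle_subG.
  case: (maximal_exists sxM) => [eqM | [K maxK sxK]].
    by rewrite -eqM cycle_cyclic in ncM.
  by exists K; rewrite -?cycle_subG.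
have [A maxA _] := cover _ (group1 M).
have /subsetPn[u Mu notAu]: ~~ (M \subset A).
  by have /proper_subn := maximal_proper maxA.
have [B maxB Bu] := cover u Mu.
have neqAB: A != B by apply: contraNneq notAu => ->.
have /subsetPn[v Av notBv] := maximal_not_sub maxA maxB neqAB.
have Mv: v \in M by apply: subsetP Av; apply: proper_sub (maximal_proper maxA).
have [C maxC Cuv] := cover (u * v) (groupM Mu Mv).
exists A, B, C; do 2!split=> //.
  by apply: contraNneq notAu => eqAC; rewrite -(groupMr u Av) eqAC.
by apply: contraNneq notBv => eqBC; rewrite -(groupMl v Bu) eqBC.
Qed.

(** If [M] is not abelian, two distinct maximal subgroups are abelian and
    generate [M], so what they share is central; and each contains ['Z(M)], since an abelian
    maximal subgroup together with a central subgroup outside it would generate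
    an abelian [M]. If [M] is abelian, its rank is at least 2, so by minimality
    it is elementary abelian of order [p ^ 2] and its maximal subgroups have
    prime order. *)
Lemma minimal_noncyclic_cap M :
    ~~ cyclic M -> (forall K, K \proper M -> cyclic K) ->
  exists D : {group gT},
    forall A B, maximal A M -> maximal B M -> A != B -> A :&: B = D.
Proof.
move=> ncM cycP.
have [abM | nabM] := boolP (abelian M).
  exists 1%G => A B maxA maxB neqAB.
  have: 1 < 'r(M) by rewrite ltnNge -abelian_rank1_cyclic.
  case/rank_geP=> E /nElemP[p] /pnElemP[sEM abelE dimE].
  have ncE: ~~ cyclic E by rewrite (abelem_cyclic abelE) dimE.
  have p_pr: prime p.
    by apply: contraT => p_npr; rewrite /logn (negPf p_npr) in dimE.
  have cardM: #|M| = (p ^ 2)%N.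
    have <-: E :=: M.
      apply/eqP; rewrite eqEproper sEM /=.
      by apply: contra ncE => /cycP.
    by rewrite (card_pgroup (abelem_pgroup abelE)) dimE.
  have [prA _] := maxgroupP maxA.
  have /(dvdn_pfactor _ _ p_pr)[m le_m2 cardA]: #|A| %| p ^ 2.
    by rewrite -cardM cardSg ?proper_sub.
  have lt_m2: m < 2.
    rewrite -(ltn_exp2l _ _ (prime_gt1 p_pr)) -cardA -cardM.
    exact: proper_card.
  have notAB := maximal_not_sub maxA maxB neqAB.
  case: m cardA lt_m2 {le_m2} => [|[|//]] cardA _.
    by case/negP: notAB; rewrite (card1_trivg cardA) sub1G.
  by apply: prime_TIg => //; rewrite cardA expn1.
exists 'Z(M)%G => A B maxA maxB neqAB.
have abmax (K : {group gT}) : maximal K M -> abelian K.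
  by move=> maxK; apply/cyclic_abelian/cycP/maximal_proper.
have join (K L : {group gT}) : maximal K M -> L \subset M -> ~~ (L \subset K) ->
    K <*> L = M.
  move=> maxK sLM; apply: contraNeq => neqM.
  have [prK maxKP] := maxgroupP maxK.
  rewrite -(maxKP (K <*> L)%G) ?joing_subl ?joing_subr //.
  by rewrite properEneq neqM join_subG proper_sub.
have sM (K : {group gT}) : maximal K M -> K \subset M.
  by move/maximal_proper/proper_sub.
have sZ (K : {group gT}) : maximal K M -> 'Z(M) \subset K.
  move=> maxK; apply: contraR nabM => notZK.
  have abY: abelian (K <*> 'Z(M)).
    rewrite abelianY abmax // center_abelian /=.
    exact: subset_trans (subsetIr M _) (centS (sM _ maxK)).
  by rewrite (join _ 'Z(M)%G maxK (center_sub M) notZK) in abY.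
have notAB := maximal_not_sub maxA maxB neqAB.
have joinBA: B <*> A = M by apply: join => //; apply: sM.
apply/eqP; rewrite eqEsubset subsetI !sZ // !andbT.
rewrite subsetI; apply/andP; split.
  exact: subset_trans (subsetIl _ _) (sM _ maxA).
rewrite -joinBA centY subsetI.
rewrite (subset_trans (subsetIr _ _)) ?(subset_trans (subsetIl _ _)) //.
  exact: abmax maxA.
exact: abmax maxB.
Qed.

Lemma cap_above D A B X Y :
    A :&: B = D -> X \subset A -> Y \subset B -> D \subset X -> D \subset Y ->
  X :&: Y = D.
Proof.
move=> capAB sXA sYB sDX sDY; apply/eqP.
by rewrite eqEsubset -{1}capAB setISS // subsetI sDX.
Qed.

(** A maximal subgroup containing both [X] and [Y] meets [A] in more than [D],
    hence equals [A], and likewise equals [B]. *)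
Lemma join_above M D A B X Y :
    (forall K L, maximal K M -> maximal L M -> K != L -> K :&: L = D) ->
    maximal A M -> maximal B M -> A != B ->
    X \subset A -> Y \subset B -> D \proper X -> D \proper Y ->
  X <*> Y = M.
Proof.
move=> capD maxA maxB neqAB sXA sYB prX prY.
have sM (K : {group gT}) : maximal K M -> K \subset M.
  by move/maximal_proper/proper_sub.
have sJM: X <*> Y \subset M.
  by rewrite join_subG (subset_trans sXA) ?(subset_trans sYB) ?sM.
have [// | [K maxK]] := maximal_exists sJM.
rewrite join_subG => /andP[sXK sYK].
have eqK (L Z : {group gT}) : maximal L M -> Z \subset L -> Z \subset K ->
    D \proper Z -> K = L.
  move=> maxL sZL sZK /proper_subn notZD; apply/eqP.
  by apply: contraNT notZD => neqKL; rewrite -(capD K L) // subsetI sZK.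
by rewrite -(eqK A X) // -(eqK B Y) // eqxx in neqAB.
Qed.

Lemma maximal_below D A :
  D \proper A -> exists2 X : {group gT}, X \subset A & maximal D X.
Proof.
move=> prDA.
have [X /mingroupP[prDX minX] sXA] :=
  @mingroup_exists gT (fun X => D \proper X) A prDA.
exists X => //; apply/maxgroupP; split=> // K prKX sDK.
apply/eqP; apply: contraT => neqKD.
have prDK: D \proper K by rewrite properEneq eq_sym neqKD.
have eqKX := minX K prDK (proper_sub prKX).
by rewrite eqKX properxx in prKX.
Qed.

Lemma noncyclic_diamond G :
    ~~ cyclic G ->
  exists M X Y C D : {group gT},
    [/\ M \subset G,
        diamond M X Y C D,
        [/\ cyclic X, cyclic Y, cyclic C & cyclic D],
        maximal D X & maximal D Y].
Proof.
move=> ncG.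
have [M /mingroupP[ncM minM] sMG] :=
  @mingroup_exists gT (fun K => ~~ cyclic K) G ncG.
have cycP (K : {group gT}) : K \proper M -> cyclic K.
  move=> prK; apply: contraT => ncK.
  have eqKM := minM K ncK (proper_sub prK).
  by rewrite eqKM properxx in prK.
have [D capD] := minimal_noncyclic_cap ncM cycP.
have [A [B [C [[maxA maxB maxC] [neqAB neqAC neqBC]]]]] := three_maximal ncM.
have prD (K L : {group gT}) : maximal K M -> maximal L M -> K != L ->
    D \proper K.
  move=> maxK maxL neqKL; rewrite -(capD K L) // properE subsetIl subsetI.
  by rewrite subxx (maximal_not_sub maxK maxL).
have [X sXA maxDX] := maximal_below (prD A B maxA maxB neqAB).
have [Y sYB maxDY] : exists2 Y : {group gT}, Y \subset B & maximal D Y.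
  by apply: maximal_below; apply: (prD B C).
have [prX prY] := (maximal_proper maxDX, maximal_proper maxDY).
have prC: D \proper C by apply: (prD C A); rewrite // eq_sym.
have [prAM prBM] := (maximal_proper maxA, maximal_proper maxB).
have prCM := maximal_proper maxC.
have [prXM prYM] := (sub_proper_trans sXA prAM, sub_proper_trans sYB prBM).
have prDM := proper_trans prX prXM.
have [sDX sDY sDC] := And3 (proper_sub prX) (proper_sub prY) (proper_sub prC).
have capXY: X :&: Y = D.
  by apply: (cap_above (capD A B maxA maxB neqAB)).
have capXC: X :&: C = D.
  by apply: (cap_above (capD A C maxA maxC neqAC)).
have capYC: Y :&: C = D.
  by apply: (cap_above (capD B C maxB maxC neqBC)).
have neq (K L : {group gT}) : K \proper L -> K != L.
  by move=> prKL; apply: contraTneq prKL => ->; rewrite properxx.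
have neq_cap (K L : {group gT}) : D \proper K -> K :&: L = D -> K != L.
  move=> prK capKL; apply: contraTneq prK => eqKL.
  by rewrite -capKL -eqKL setIid properxx.
exists M, X, Y, C, D; split=> //; last by split; apply: cycP.
split=> //.
  rewrite /= !inE !negb_or !(eq_sym M) !(eq_sym _ D).
  rewrite (neq X M) // (neq Y M) // (neq C M) // (neq D M) //.
  rewrite (neq D X) // (neq D Y) // (neq D C) //.
  by rewrite (neq_cap X Y) // (neq_cap X C) // (neq_cap Y C).
by split; [apply: (@join_above M D A B) | apply: (@join_above M D A C)
          | apply: (@join_above M D B C)].
Qed.

End CyclicDiamond.

Theorem theorem2p4 (gT : finGroupType) (G : {group gT}) :
  cyclic G <->
  ~ (exists (H : {group gT}) (x y z a : gT),
       [/\ H \subset G,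
           [/\ x \in G, y \in G, z \in G & a \in G],
           diamond H <[x]>%G <[y]>%G <[z]>%G <[a]>%G,
           maximal <[a]> <[x]> &
           maximal <[a]> <[y]>]).
Proof.
split=> [cycG [H [x [y [z [a [sHG _ diaH _ _]]]]]] | no_diamond].
  exact: cyclic_no_diamond (cyclicS sHG cycG) diaH.
apply: contraT => /noncyclic_diamond[M [X [Y [C [D [sMG dia [cX cY cC cD]]]]]]].
have [x defX] := cyclic_genP cX; have [y defY] := cyclic_genP cY.
have [z defC] := cyclic_genP cC; have [a defD] := cyclic_genP cD.
rewrite {}defX {}defY {}defC {}defD {cX cY cC cD X Y C D} in dia *.
move=> maxx maxy; case: no_diamond; exists M, x, y, z, a; split=> //.
have [_ [joinxy joinxz _] [meetxy _ _]] := dia.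
have sxM: <[x]> \subset M by rewrite -joinxy joing_subl.
rewrite -!cycle_subG; split; apply: subset_trans sMG => //.
- by rewrite -joinxy joing_subr.
- by rewrite -joinxz joing_subr.
- by apply: subset_trans sxM; rewrite -meetxy subsetIl.
Qed.
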